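(* Let $\alpha$ and $\beta$ be smooth functions of $t$ with $\beta\neq0$, and let $a$ and $b$ be arbitrary constants. Then the function $$u=\frac{x+b}{\int e^{-\int\alpha(t)\,dt}\,dt+a}\,e^{-\int\alpha(t)\,dt}$$ is a solution of the equation $$u_t+uu_x+\alpha(t)u+\beta(t)u_{xxxxx}=0.$$
   Context: Integrals denote a fixed choice of antiderivatives, the same choice being used in both occurrences of $\int\alpha(t)\,dt$; $t$ ranges over an interval where the denominator does not vanish. *)

(* Defs.v *)
From Stdlib Require Import Reals.
From Coquelicot Require Import Coquelicot.
Open Scope R_scope.

Definition is_interval (I : R -> Prop) : Prop :=
  forall r s t : R, I r -> I t -> r <= s <= t -> I s.

(* To be used on open sets: Coquelicot's derivatives are two-sided. *)
Definition smooth_on (J : R -> Prop) (f : R -> R) : Prop :=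
  forall (n : nat) (t : R), J t -> ex_derive_n f n t.

Definition antiderivative_on (J : R -> Prop) (f F : R -> R) : Prop :=
  forall t : R, J t -> is_derive F t (f t).

(* Classical solutions u(t, x), for t in I and x in R, of
     u_t + u u_x + alpha(t) u + beta(t) u_xxxxx = 0.
   [Derive] and [Derive_n] are total functions, so the existence of the
   derivatives is required separately; all orders up to 5 are listed because
   [ex_derive_n f 5 x] by itself only says that [Derive_n f 4] is
   differentiable at x. *)
Definition is_solution_on (I : R -> Prop) (alpha beta : R -> R)
    (u : R -> R -> R) : Prop :=
  forall t x : R, I t ->
    ex_derive (fun s => u s x) t /\
    (forall k : nat, (k <= 5)%nat -> ex_derive_n (fun y => u t y) k x) /\
    Derive (fun s => u s x) t
      + u t x * Derive (fun y => u t y) x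
      + alpha t * u t x
      + beta t * Derive_n (fun y => u t y) 5 x = 0.

(* Main.v *)
(** The function is [u = c(t) (x + b)] with [c = exp (-A) / (E + a)].  Since
    [E' = exp (-A)] and [A' = alpha], [c] solves the Bernoulli equation
    [c' + c^2 + alpha c = 0], which is the equation for [u] divided by [x + b];
    [u_xxxxx] vanishes because [u] is affine in [x]. *)
Require Import Defs.
From Stdlib Require Import Reals.
From Coquelicot Require Import Coquelicot.
Open Scope R_scope.

(** A closed form at every order and point lets the induction differentiate the formula for order
    [k] in place of [Derive_n]. *)
Lemma is_derive_n_affine (b d e : R) (k : nat) (x : R) :
  is_derive_n (fun y => (y + b) / d * e) k x
    (match k with 0%nat => (x + b) / d * e | 1%nat => / d * e | _ => 0 end).
Proof.
  revert x; induction k as [|k IH]; intros x; [reflexivity|].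
  apply (is_derive_ext (fun y =>
    match k with 0%nat => (y + b) / d * e | 1%nat => / d * e | _ => 0 end)).
  - intros y; symmetry; apply is_derive_n_unique, IH.
  - destruct k as [|[|k]].
    + unfold Rdiv; auto_derive; [exact I | ring].
    + apply @is_derive_const.
    + apply @is_derive_const.
Qed.

(** With [c] = x + b the two terms of the value are -u u_x and -alpha u. *)
Lemma is_derive_profile (a c alpha t : R) (A E : R -> R) :
  is_derive A t alpha -> is_derive E t (exp (- A t)) -> E t + a <> 0 ->
  is_derive (fun s => c / (E s + a) * exp (- A s)) t
    (- c * (exp (- A t) / (E t + a)) ^ 2
     - alpha * (c / (E t + a) * exp (- A t))).
Proof.
  intros HA HE Hd.
  auto_derive.
  - repeat split; [now exists (exp (- A t)) | exact Hd | now exists alpha].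
  - change (Derive (fun x => E x) t) with (Derive E t).
    change (Derive (fun x => A x) t) with (Derive A t).
    rewrite (is_derive_unique E t _ HE),
      (is_derive_unique A t _ HA).
    field; exact Hd.
Qed.

Theorem mainTheorem8 (J : R -> Prop) (HJopen : open J) (HJ : is_interval J)
  (alpha beta : R -> R)
  (Halpha : smooth_on J alpha) (Hbeta : smooth_on J beta)
  (Hbeta0 : exists t : R, J t /\ beta t <> 0)
  (a b : R)
  (A E : R -> R)
  (HA : antiderivative_on J alpha A)
  (HE : antiderivative_on J (fun t => exp (- A t)) E)
  (I : R -> Prop) (HI : is_interval I) (HIJ : forall t : R, I t -> J t)
  (Hden : forall t : R, I t -> E t + a <> 0) :
  is_solution_on I alpha beta
    (fun t x => (x + b) / (E t + a) * exp (- A t)).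
Proof.
  intros t x Ht; cbv beta.
  pose proof (is_derive_profile a (x + b) (alpha t) t A E
    (HA t (HIJ t Ht)) (HE t (HIJ t Ht)) (Hden t Ht)) as Hut.
  pose proof (is_derive_n_affine b (E t + a) (exp (- A t))) as Hux.
  repeat split.
  - eexists; exact Hut.
  (* Order 0 asks only for [True]; plain [I] is the interval here. *)
  - intros k _; destruct k as [|k]; [exact Logic.I|].
    eexists; exact (Hux (S k) x).
  - apply is_derive_unique in Hut.
    pose proof (is_derive_unique _ _ _ (Hux 1%nat x)) as Hux1.
    pose proof (is_derive_n_unique _ _ _ _ (Hux 5%nat x)) as Hux5.
    (* Congruence works up to conversion: at order 1 [is_derive_n] differentiates [Derive_n f 0],
       which only reduces to [f]. *)
    refine (eq_trans (f_equal2 Rplus (f_equal2 Rplus (f_equal2 Rplus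
      Hut (f_equal (Rmult _) Hux1)) eq_refl) (f_equal (Rmult _) Hux5)) _).
    field; exact (Hden t Ht).
Qed.
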